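(* There exist deformations of the round metric on $S^{2n+1}$, $n\ge 3$, which are non-Sasakian K-contact structures for which the component $\mathfrak{g}_2$ of the Lie algebra of the isometry group contains Killing vector fields of non-constant length.
   Context: A K-contact structure on a Riemannian manifold $(M,g)$ is a unit length Killing vector field $\xi$ such that the endomorphism $\varphi$ defined by $g(\varphi\cdot,\cdot)=\frac12 d\xi(\cdot,\cdot)$ (where $\xi$ is identified with the 1-form $\eta=g(\xi,\cdot)$) satisfies $\varphi^2=-\mathrm{Id}+\eta\otimes\xi$. A Sasakian structure is a unit length Killing vector field $\xi$ such that $(\nabla_X(\nabla\xi))(Y)=g(\xi,Y)X-g(X,Y)\xi$ for all $X,Y$, where $\nabla$ is the Levi-Civita connection. On a compact K-contact manifold $(M,g,\xi)$ the Lie algebra of the isometry group, identified with the Lie algebra of Killing vector fields, decomposes as a vector space as $\mathfrak{g}_0\oplus\mathfrak{g}_2$, where $\mathcal{L}_\xi=0$ on $\mathfrak{g}_0$ and $\mathcal{L}_\xi\circ\mathcal{L}_\xi=-4\,\mathrm{Id}$ on $\mathfrak{g}_2$. *)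

(* Defs.v *)
From HB Require Import structures.
From mathcomp Require Import all_boot all_order all_algebra.
From mathcomp Require Import all_classical all_reals all_analysis.
Set Implicit Arguments.
Unset Strict Implicit.
Unset Printing Implicit Defensive.
Import Order.TTheory GRing.Theory Num.Theory.
Import numFieldNormedType.Exports.
Local Open Scope classical_set_scope.
Local Open Scope ring_scope.

(* C^infinity on an open set U: every iterated directional derivative is
   differentiable at every point of U. Meant for finite-dimensional V. *)
Definition smooth_on (R : realType) (V W : normedModType R) (U : set V)
    (f : V -> W) : Prop :=
  forall (vs : seq V) (x : V), U x ->
    differentiable (foldr (fun v (h : V -> W) => 'D_v h) f vs) x.

(* Differential geometry of the unit sphere S of R^d, whose tangent space at p
   is the orthogonal complement of p. Objects living on S are represented by
   functions on all of R^d, of which only the values at points of S (and, for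
   metrics and endomorphisms, on tangent vectors) are ever constrained. *)
Section Sphere.
Context {R : realType} {d : nat}.
Local Notation V := 'rV[R]_d.

(* The norm `|x| of the library is the sup norm on 'rV, hence the explicit
   Euclidean inner product. *)
Definition dot (u v : V) : R := \sum_(i < d) u 0 i * v 0 i.

Definition unit_sphere : set V := [set p | dot p p = 1].

Definition tangent (p v : V) : Prop := dot p v = 0.

(* The extension to R^d minus the origin, constant along rays, of a map on S,
   i.e. its composition with the retraction x |-> x / |x|. A map on S is smooth
   iff this extension is, and its differential on tangent vectors is the
   restriction of that of the extension. *)
Definition ray_ext (T : Type) (f : V -> T) (x : V) : T :=
  f ((Num.sqrt (dot x x))^-1 *: x).

Definition smooth_map (W : normedModType R) (f : V -> W) : Prop :=
  smooth_on [set x : V | x != 0] (ray_ext f).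

Definition vector_field (X : V -> V) : Prop :=
  smooth_map X /\ forall p, unit_sphere p -> tangent p (X p).

(* derivative of f along the vector field X *)
Definition der (W : normedModType R) (X : V -> V) (f : V -> W) (p : V) : W :=
  'D_(X p) (ray_ext f) p.

Definition bracket (X Y : V -> V) (p : V) : V := der X Y p - der Y X p.

(* g p u v is the metric at p evaluated on the tangent vectors u, v. *)
Definition riemannian_metric (g : V -> V -> V -> R) : Prop :=
  [/\ forall p, unit_sphere p -> forall (a : R) (u v w : V),
        tangent p u -> tangent p v -> tangent p w ->
        g p (a *: u + v) w = a * g p u w + g p v w,
      forall p, unit_sphere p -> forall u v : V,
        tangent p u -> tangent p v -> g p u v = g p v u,
      forall p, unit_sphere p -> forall u : V,
        tangent p u -> u != 0 -> 0 < g p u u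
    & forall X Y, vector_field X -> vector_field Y ->
        smooth_map (fun p => g p (X p) (Y p) : R^o)].

Definition round_metric (p u v : V) : R := dot u v.

Definition eq_metric (g h : V -> V -> V -> R) : Prop :=
  forall p u v, unit_sphere p -> tangent p u -> tangent p v ->
    g p u v = h p u v.

Definition ip (g : V -> V -> V -> R) (X Y : V -> V) (p : V) : R^o :=
  g p (X p) (Y p).

Definition length (g : V -> V -> V -> R) (X : V -> V) (p : V) : R :=
  Num.sqrt (ip g X X p).

Definition killing (g : V -> V -> V -> R) (X : V -> V) : Prop :=
  vector_field X /\
  forall Y Z, vector_field Y -> vector_field Z ->
    forall p, unit_sphere p ->
      der X (ip g Y Z) p = ip g (bracket X Y) Z p + ip g Y (bracket X Z) p.

Definition unit_killing (g : V -> V -> V -> R) (xi : V -> V) : Prop :=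
  killing g xi /\ forall p, unit_sphere p -> length g xi p = 1.

(* exterior derivative of the 1-form g(xi, .), in the normalization
   d eta (X, Y) = X (eta Y) - Y (eta X) - eta [X, Y] *)
Definition d_dual (g : V -> V -> V -> R) (xi X Y : V -> V) (p : V) : R :=
  der X (ip g xi Y) p - der Y (ip g xi X) p - ip g xi (bracket X Y) p.

Definition k_contact (g : V -> V -> V -> R) (xi : V -> V) : Prop :=
  [/\ riemannian_metric g, unit_killing g xi
    & exists phi : V -> V -> V,
      [/\ forall p v, unit_sphere p -> tangent p v -> tangent p (phi p v),
          forall X Y, vector_field X -> vector_field Y ->
            forall p, unit_sphere p ->
              g p (phi p (X p)) (Y p) = 2^-1 * d_dual g xi X Y p
        & forall p v, unit_sphere p -> tangent p v ->
            phi p (phi p v) = - v + g p (xi p) v *: xi p]].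

Definition connection (nabla : (V -> V) -> (V -> V) -> (V -> V)) : Prop :=
  [/\ forall X Y, vector_field X -> vector_field Y ->
        vector_field (nabla X Y),
      forall (f : V -> R^o) X X' Y, smooth_map f ->
        vector_field X -> vector_field X' -> vector_field Y ->
        forall p, unit_sphere p ->
          nabla (fun q => f q *: X q + X' q) Y p
          = f p *: nabla X Y p + nabla X' Y p
    & forall (f : V -> R^o) X Y Y', smooth_map f ->
        vector_field X -> vector_field Y -> vector_field Y' ->
        forall p, unit_sphere p ->
          nabla X (fun q => f q *: Y q + Y' q) p
          = der X f p *: Y p + f p *: nabla X Y p + nabla X Y' p].

Definition levi_civita (g : V -> V -> V -> R)
    (nabla : (V -> V) -> (V -> V) -> (V -> V)) : Prop :=
  [/\ connection nabla,
      forall X Y, vector_field X -> vector_field Y ->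
        forall p, unit_sphere p ->
          nabla X Y p - nabla Y X p = bracket X Y p
    & forall X Y Z, vector_field X -> vector_field Y -> vector_field Z ->
        forall p, unit_sphere p ->
          der X (ip g Y Z) p = ip g (nabla X Y) Z p + ip g Y (nabla X Z) p].

(* (nabla_X (nabla xi)) Y = nabla_X (nabla_Y xi) - nabla_(nabla_X Y) xi *)
Definition sasakian (g : V -> V -> V -> R) (xi : V -> V) : Prop :=
  [/\ riemannian_metric g, unit_killing g xi
    & exists nabla, levi_civita g nabla /\
      forall X Y, vector_field X -> vector_field Y ->
        forall p, unit_sphere p ->
          nabla X (nabla Y xi) p - nabla (nabla X Y) xi p
          = ip g xi Y p *: X p - ip g X Y p *: xi p].

(* Killing fields X with L_xi (L_xi X) = -4 X *)
Definition g2_component (g : V -> V -> V -> R) (xi X : V -> V) : Prop :=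
  killing g X /\
  forall p, unit_sphere p -> bracket xi (bracket xi X) p = - 4 *: X p.

Definition constant_on_sphere (f : V -> R) : Prop :=
  exists c, forall p, unit_sphere p -> f p = c.

(* Families are indexed by t with |t| < e; smoothness is joint in t and p. *)
Definition time_domain (e : R) : set (R^o * V)%type :=
  [set tx | `|tx.1| < e /\ tx.2 != 0].

Definition smooth_vector_family (e : R) (xi : R -> V -> V) : Prop :=
  smooth_on (time_domain e) (fun tx => ray_ext (xi tx.1) tx.2).

Definition smooth_metric_family (e : R) (g : R -> V -> V -> V -> R) : Prop :=
  forall X Y, vector_field X -> vector_field Y ->
    smooth_on (time_domain e) (fun tx => ray_ext (ip (g tx.1) X Y) tx.2).

End Sphere.

(* Main.v *)
(* Identify R^(2n+2) with C^(n+1), with complex structure J, so that xi = J q is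
   the Reeb field of the round Sasakian structure. Let P1, P2 be the projections
   on two complex coordinate lines, a = |P1 q|^2 P2 q - |P2 q|^2 P1 q, b = J a.
   The vectors a, b are orthogonal to q and xi, so F_t u = u + t <b, u> a is a
   unimodular shear of the complex line spanned by a which preserves xi, eta and
   d eta; hence g_t (u, v) = <F_t u, F_t v> is K-contact with
   phi = F_t^-1 J F_t. A linear skew field is Killing for g_t as soon as it
   preserves a and b. This applies to J and also, n + 1 being at least 4, to a
   quaternionic rotation A of two further coordinates: A anticommutes with J, so
   it lies in g_2, and its length |A q| is not constant. Finally, if g_t were
   Sasakian, the Nijenhuis tensor of phi would be proportional to xi; evaluated
   on a and Y = |Q q|^2 q - Q q, where Q = P1 + P2, it is, up to a nonzero
   factor, t |a|^2 (1 - |Q q|^2) phi a. *)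

From HB Require Import structures.
Require Import Defs.
From mathcomp Require Import all_boot all_order all_algebra.
From mathcomp Require Import all_classical all_reals all_analysis.
From mathcomp Require Import ring lra zify.
Import Order.TTheory GRing.Theory Num.Theory.
Import numFieldNormedType.Exports.
Local Open Scope ring_scope.

(** * Directional derivatives and smooth maps *)

Section Calculus.
Set Implicit Arguments.
Unset Strict Implicit.
Context {R : realType}.

(** Differentiability and the value of the derivative travel together, so that the rules below chain
    without separate side conditions. *)
Definition has_deriv {V W : normedModType R} (f : V -> W) (x v : V) (w : W) :=
  differentiable f x /\ 'D_v f x = w.

Lemma has_derivD {V W : normedModType R} (f g : V -> W) x v a b :
  has_deriv f x v a -> has_deriv g x v b ->
  has_deriv (fun y => f y + g y) x v (a + b).
Proof.
move=> [df <-] [dg <-]; have dfg : differentiable (f + g) x.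
  exact: differentiableD.
by split=> //; rewrite [LHS](deriveE _ dfg) diffD //= -!deriveE.
Qed.

Lemma has_derivN {V W : normedModType R} (f : V -> W) x v a :
  has_deriv f x v a -> has_deriv (fun y => - f y) x v (- a).
Proof.
move=> [df <-]; have dNf : differentiable (- f) x by exact: differentiableN.
split=> //; rewrite [LHS](deriveE _ dNf) (deriveE _ df).
by rewrite diffN.
Qed.

Lemma has_derivB {V W : normedModType R} (f g : V -> W) x v a b :
  has_deriv f x v a -> has_deriv g x v b ->
  has_deriv (fun y => f y - g y) x v (a - b).
Proof. by move=> df dg; apply: has_derivD => //; exact: has_derivN. Qed.

Lemma has_deriv_cst {V W : normedModType R} (c : W) (x v : V) :
  has_deriv (fun=> c) x v 0.
Proof. by split; [exact: differentiable_cst|exact: derive_cst]. Qed.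

Lemma has_deriv_id {V : normedModType R} (x v : V) : has_deriv id x v v.
Proof.
split; last exact: derive_id.
by apply: (@linear_differentiable _ _ _ idfun) => y; exact: cvg_id.
Qed.

Lemma has_deriv_lin {V W Z : normedModType R} (L : {linear W -> Z})
    (f : V -> W) x v a : continuous L ->
  has_deriv f x v a -> has_deriv (fun y => L (f y)) x v (L a).
Proof.
move=> cL [df <-].
have dL : differentiable L (f x) by exact: linear_differentiable.
have dLf : differentiable (L \o f) x by exact: differentiable_comp.
by split=> //; rewrite [LHS](deriveE _ dLf) diff_comp // diff_lin //= deriveE.
Qed.

Lemma has_deriv_precomp {V W Z : normedModType R} (L : {linear V -> W})
    (f : W -> Z) x v a : continuous L ->
  has_deriv f (L x) (L v) a -> has_deriv (fun y => f (L y)) x v a.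
Proof.
move=> cL [df <-].
have dL : differentiable L x by exact: linear_differentiable.
have dLf : differentiable (f \o L) x by exact: differentiable_comp.
by split=> //; rewrite [LHS](deriveE _ dLf) diff_comp //= diff_lin // deriveE.
Qed.

Lemma has_deriv_bilin {V W Z T : normedModType R} (B : {bilinear W -> Z -> T})
    (f : V -> W) (g : V -> Z) x v a b :
  continuous (fun p : W * Z => B p.1 p.2) ->
  has_deriv f x v a -> has_deriv g x v b ->
  has_deriv (fun y => B (f y) (g y)) x v (B a (g x) + B (f x) b).
Proof.
move=> cB [df <-] [dg <-]; pose h y := (f y, g y).
have dh : differentiable h x by exact: differentiable_pair.
have dB : differentiable (fun p : W * Z => B p.1 p.2) (h x).
  exact: differentiable_bilin.
have dBh : differentiable ((fun p : W * Z => B p.1 p.2) \o h) x.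
  exact: differentiable_comp.
split=> //; rewrite [LHS](deriveE _ dBh) diff_comp //= diff_bilin //=.
by rewrite diff_pair //= !deriveE // addrC.
Qed.

(** The first-order expansion of [f] at [x] is also one of [g], and uniqueness of the differential
    then identifies the two differentials. *)
Lemma differentiable_near {V W : normedModType R} (f g : V -> W) x :
  (\near x, f x = g x) -> differentiable f x -> differentiable g x.
Proof.
move=> fg df.
have e : g \o shift x = cst (g x) + 'd f x +o_ 0 id.
  have /eqaddoP fo := diff_locally df.
  apply/eqaddoP => eps eps0; have fo' := fo _ eps0.
  have fg0 : \forall y \near (0 : V), f (y + x) = g (y + x).
    by have := fg; rewrite {1}(near_shift 0) /= subr0.
  rewrite -(nbhs_singleton fg); near=> y.
  have -> : (g \o shift x - (cst (f x) + 'd f x)) y =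
            (f \o shift x - (cst (f x) + 'd f x)) y.
    by rewrite !fctE /= (near fg0 y).
  by near: y.
have dg : 'd g x = 'd f x :> (V -> W).
  exact: diff_unique (diff_continuous df) e.
by apply/diff_locallyP; rewrite dg; split; [exact: diff_continuous|].
Unshelve. all: by end_near. Qed.

Lemma has_deriv_near {V W : normedModType R} (f g : V -> W) x v a :
  (\near x, f x = g x) -> has_deriv f x v a -> has_deriv g x v a.
Proof.
move=> fg [df <-]; split; last exact/esym/near_eq_derive.
exact: differentiable_near df.
Qed.

(* [smooth_on U f] for lists of at most [k] vectors, in a form suited to
   induction on [k]. *)
Fixpoint smoothn {V W : normedModType R} (k : nat) (U : set V) (f : V -> W)
    : Prop :=
  (forall x, U x -> differentiable f x) /\
  if k is k'.+1 then forall v, smoothn k' U ('D_v f) else True.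

(** [foldr] differentiates first along the last vector of the list, so the recursion on [k] peels
    lists from the right. *)
Lemma smooth_onP {V W : normedModType R} (U : set V) (f : V -> W) :
  smooth_on U f <-> forall k, smoothn k U f.
Proof.
split=> [sf k|sf vs x Ux].
  elim: k f sf => [|k IH] f sf; first by split=> // x; exact: (sf [::]).
  split=> [x|v]; first exact: (sf [::]).
  by apply: IH => vs x Ux; have := sf (rcons vs v) x Ux; rewrite foldr_rcons.
have {sf} := sf (size vs).
elim/last_ind: vs f => [|vs v IH] f; first by case=> sf _; exact: sf.
by rewrite size_rcons foldr_rcons => -[_ /(_ v) /IH].
Qed.

Lemma smoothn_diff {V W : normedModType R} k (U : set V) (f : V -> W) x :
  smoothn k U f -> U x -> differentiable f x.
Proof. by case: k => [|k] [df _]; exact: df. Qed.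

Lemma smoothnW {V W : normedModType R} k (U : set V) (f : V -> W) :
  smoothn k.+1 U f -> smoothn k U f.
Proof.
elim: k f => [|k IH] f [df Df]; first by [].
by split=> // v; apply: IH.
Qed.

Lemma smoothn_eq {V W : normedModType R} k (U : set V) (f g : V -> W) :
  open U -> (forall x, U x -> f x = g x) -> smoothn k U f -> smoothn k U g.
Proof.
move=> oU; elim: k f g => [|k IH] f g fg [df Df].
  split=> // x Ux; apply: differentiable_near (df x Ux).
  by apply: filterS (open_nbhs_nbhs (conj oU Ux)) => y; exact: fg.
have fgn x : U x -> \near x, f x = g x.
  by move=> Ux; apply: filterS (open_nbhs_nbhs (conj oU Ux)) => y; exact: fg.
split=> [x Ux|v]; first exact: differentiable_near (fgn x Ux) (df x Ux).
by apply: IH (Df v) => x Ux; exact: near_eq_derive (fgn x Ux).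
Qed.

(** The induction step of all the closure properties below: a formula for the derivative, needed
    only on the open set [U], gains one order of smoothness. *)
Lemma smoothnS {V W : normedModType R} k (U : set V) (f : V -> W)
    (f' : V -> V -> W) : open U ->
  (forall x v, U x -> has_deriv f x v (f' v x)) ->
  (forall v, smoothn k U (f' v)) -> smoothn k.+1 U f.
Proof.
move=> oU df sf'; split=> [x Ux|v]; first by have [] := df x 0 Ux.
by apply: smoothn_eq (sf' v) => // x Ux; have [_ ->] := df x v Ux.
Qed.

Lemma smoothn_has_deriv {V W : normedModType R} k (U : set V) (f : V -> W) x v :
  smoothn k U f -> U x -> has_deriv f x v ('D_v f x).
Proof. by move=> sf Ux; split=> //; exact: smoothn_diff sf Ux. Qed.

Lemma smoothnD {V W : normedModType R} k (U : set V) (f g : V -> W) :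
  open U -> smoothn k U f -> smoothn k U g -> smoothn k U (fun x => f x + g x).
Proof.
move=> oU; elim: k f g => [|k IH] f g sf sg.
  split=> // x Ux.
  exact: differentiableD (smoothn_diff sf Ux) (smoothn_diff sg Ux).
apply: (smoothnS (f' := fun v x => 'D_v f x + 'D_v g x)) => // [x v Ux|v].
  exact: has_derivD (smoothn_has_deriv v sf Ux) (smoothn_has_deriv v sg Ux).
by apply: IH; [case: sf => _|case: sg => _]; apply.
Qed.

Lemma smoothnN {V W : normedModType R} k (U : set V) (f : V -> W) :
  open U -> smoothn k U f -> smoothn k U (fun x => - f x).
Proof.
move=> oU; elim: k f => [|k IH] f sf.
  by split=> // x Ux; apply: differentiableN (smoothn_diff sf Ux).
apply: (smoothnS (f' := fun v x => - 'D_v f x)) => // [x v Ux|v].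
  exact: has_derivN (smoothn_has_deriv v sf Ux).
by apply: IH; case: sf => _; apply.
Qed.

Lemma smoothnB {V W : normedModType R} k (U : set V) (f g : V -> W) :
  open U -> smoothn k U f -> smoothn k U g -> smoothn k U (fun x => f x - g x).
Proof. by move=> oU sf sg; apply: smoothnD => //; exact: smoothnN. Qed.

Lemma smoothn_bilin {V W Z T : normedModType R} (B : {bilinear W -> Z -> T})
    k (U : set V) (f : V -> W) (g : V -> Z) :
  open U -> continuous (fun p : W * Z => B p.1 p.2) ->
  smoothn k U f -> smoothn k U g -> smoothn k U (fun x => B (f x) (g x)).
Proof.
move=> oU cB; elim: k f g => [|k IH] f g sf sg.
  split=> // x Ux.
  by have [] := has_deriv_bilin cB (smoothn_has_deriv 0 sf Ux)
    (smoothn_has_deriv 0 sg Ux).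
apply: (smoothnS
  (f' := fun v x => B ('D_v f x) (g x) + B (f x) ('D_v g x))) => // [x v Ux|v].
  exact: has_deriv_bilin cB (smoothn_has_deriv v sf Ux)
    (smoothn_has_deriv v sg Ux).
case: (sf) (sg) => _ Df [_ Dg].
exact: smoothnD oU (IH _ _ (Df v) (smoothnW sg)) (IH _ _ (smoothnW sf) (Dg v)).
Qed.

Lemma smoothn_cst {V W : normedModType R} k (U : set V) (c : W) :
  open U -> smoothn k U (fun=> c).
Proof.
move=> oU; elim: k c => [|k IH] c.
  by split=> // x _; have [] := has_deriv_cst c x 0.
apply: (smoothnS (f' := fun _ _ => 0)) => // x v _; exact: has_deriv_cst.
Qed.

Lemma smoothn_id {V : normedModType R} k (U : set V) : open U -> smoothn k U id.
Proof.
move=> oU; case: k => [|k].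
  by split=> // x _; have [] := has_deriv_id x 0.
apply: (smoothnS (f' := fun v _ => v)) => // [x v _|v].
  exact: has_deriv_id.
exact: smoothn_cst.
Qed.

Lemma smoothn_lin {V W Z : normedModType R} (L : {linear W -> Z}) k (U : set V)
    (f : V -> W) : open U -> continuous L ->
  smoothn k U f -> smoothn k U (fun x => L (f x)).
Proof.
move=> oU cL; elim: k f => [|k IH] f sf.
  split=> // x Ux.
  by have [] := has_deriv_lin cL (smoothn_has_deriv 0 sf Ux).
apply: (smoothnS (f' := fun v x => L ('D_v f x))) => // [x v Ux|v].
  exact: has_deriv_lin cL (smoothn_has_deriv v sf Ux).
by apply: IH; case: sf => _; apply.
Qed.

Lemma smoothn_precomp {V W Z : normedModType R} (L : {linear V -> W}) k
    (U : set V) (U' : set W) (f : W -> Z) : open U -> continuous L ->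
  (forall x, U x -> U' (L x)) ->
  smoothn k U' f -> smoothn k U (fun x => f (L x)).
Proof.
move=> oU cL UU'; elim: k f => [|k IH] f sf.
  split=> // x Ux; have [] // := has_deriv_precomp cL
    (smoothn_has_deriv (L 0) sf (UU' _ Ux)).
apply: (smoothnS (f' := fun v x => 'D_(L v) f (L x))) => // [x v Ux|v].
  exact: has_deriv_precomp cL (smoothn_has_deriv (L v) sf (UU' _ Ux)).
by case: sf => _ /(_ (L v)); exact: IH.
Qed.

End Calculus.

(** * Chain rule for curves and products with scalar functions *)

Section Scalar.
Set Implicit Arguments.
Unset Strict Implicit.
Context {R : realType}.

Lemma has_deriv_comp {V W : normedModType R} (h : R -> W) h'
    (f : V -> R^o) x v a :
  is_derive (f x) 1 h h' -> has_deriv f x v a ->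
  has_deriv (fun y => h (f y)) x v (a *: h').
Proof.
move=> [dh <-] [df <-].
have dh' : differentiable h (f x) by apply/derivable1_diffP.
have dhf : differentiable (h \o f) x by exact: differentiable_comp.
split=> //; rewrite [LHS](deriveE _ dhf) diff_comp //= diff1E //.
by rewrite -deriveE // derive1E.
Qed.

(** A named form of scaling, with scalars in the normed module [R^o], to which a bilinear structure
    can be attached. *)
Definition scale_op (W : normedModType R) (k : R^o) (u : W) : W := k *: u.

Lemma scale_is_bilinear (W : normedModType R) :
  bilinear_for *:%R *:%R (@scale_op W).
Proof.
rewrite /scale_op; split=> [u|k] a x y /=; first by rewrite scalerDl scalerA.
by rewrite scalerDr !scalerA [k * a]mulrC.
Qed.

HB.instance Definition _ (W : normedModType R) :=
  bilinear_isBilinear.Build R R^o W W _ _ (@scale_op W)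
    (scale_is_bilinear W).

Lemma has_derivZ {V W : normedModType R} (k : V -> R^o) (f : V -> W) x v a b :
  has_deriv k x v a -> has_deriv f x v b ->
  has_deriv (fun y => k y *: f y) x v (a *: f x + k x *: b).
Proof. exact: (has_deriv_bilin (B := @scale_op W)) (@scale_continuous _ _). Qed.

Lemma smoothnZ {V W : normedModType R} n (U : set V) (k : V -> R^o)
    (f : V -> W) :
  open U -> smoothn n U k -> smoothn n U f -> smoothn n U (fun x => k x *: f x).
Proof.
move=> oU.
exact: (smoothn_bilin (B := @scale_op W)) oU (@scale_continuous _ _).
Qed.
End Scalar.

(** * The Euclidean inner product *)

Section Euclid.
Set Implicit Arguments.
Unset Strict Implicit.
Context {R : realType} {d : nat}.
Local Notation V := 'rV[R]_d.

Lemma dotC (u v : V) : dot u v = dot v u.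
Proof. by apply: eq_bigr => i _; rewrite mulrC. Qed.

Lemma dotDl (u v w : V) : dot (u + v) w = dot u w + dot v w.
Proof. by rewrite -big_split; apply: eq_bigr => i _; rewrite mxE mulrDl. Qed.

Lemma dotZl k (u w : V) : dot (k *: u) w = k * dot u w.
Proof.
by rewrite /dot big_distrr; apply: eq_bigr => i _; rewrite mxE -mulrA.
Qed.

Lemma dotDr (u v w : V) : dot w (u + v) = dot w u + dot w v.
Proof. by rewrite dotC dotDl !(dotC w). Qed.

Lemma dotZr k (u w : V) : dot w (k *: u) = k * dot w u.
Proof. by rewrite dotC dotZl dotC. Qed.

Lemma dotNl (u w : V) : dot (- u) w = - dot u w.
Proof. by rewrite -scaleN1r dotZl mulN1r. Qed.

Lemma dotNr (u w : V) : dot w (- u) = - dot w u.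
Proof. by rewrite dotC dotNl dotC. Qed.

Lemma dot0l (w : V) : dot 0 w = 0.
Proof. by rewrite -(scale0r 0) dotZl mul0r. Qed.

Lemma dot0r (w : V) : dot w 0 = 0.
Proof. by rewrite dotC dot0l. Qed.

Definition dotE := (dotDl, dotDr, dotZl, dotZr, dotNl, dotNr, dot0l, dot0r).

Lemma dot_ge0 (u : V) : 0 <= dot u u.
Proof. by apply: sumr_ge0 => i _; rewrite -expr2 sqr_ge0. Qed.

Lemma dot_eq0 (u : V) : (dot u u == 0) = (u == 0).
Proof.
apply/eqP/eqP => [|->]; last exact: dot0l.
move=> /eqP; rewrite psumr_eq0 => [/allP u0|i _]; last first.
  by rewrite -expr2 sqr_ge0.
apply/rowP => i; rewrite mxE; apply/eqP.
by have := u0 i (mem_index_enum _); rewrite mulf_eq0 orbb.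
Qed.

Lemma dot_gt0 (u : V) : (0 < dot u u) = (u != 0).
Proof. by rewrite lt_def dot_eq0 dot_ge0 andbT. Qed.

(** In coordinates, [L] is a finite sum of coordinate functions times constant vectors. *)
Lemma rV_linear_continuous (W : normedModType R) (L : {linear V -> W}) :
  continuous L.
Proof.
have -> : (L : V -> W) = (\sum_i fun x : V => x 0 i *: L (delta_mx 0 i)).
  apply/funext => x; rewrite fct_sumE {1}(row_sum_delta x) linear_sum.
  by apply: eq_bigr => i _; rewrite linearZ.
move=> x; apply: differentiable_continuous; apply: differentiable_sum => i.
by apply: differentiableZl; exact: differentiable_coord.
Qed.

Lemma has_deriv_linear {U W : normedModType R}
    (L : {linear V -> W}) (f : U -> V) x v a :
  has_deriv f x v a -> has_deriv (fun y => L (f y)) x v (L a).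
Proof. exact: has_deriv_lin (@rV_linear_continuous _ L). Qed.

Lemma smoothn_linear {U W : normedModType R} n (O : set U) (L : {linear V -> W})
    (f : U -> V) :
  open O -> smoothn n O f -> smoothn n O (fun y => L (f y)).
Proof. by move=> oO; exact: smoothn_lin oO (@rV_linear_continuous _ L). Qed.

Definition dot_op (u v : V) : R^o := dot u v.

Lemma dot_is_bilinear : bilinear_for *:%R *:%R dot_op.
Proof. by rewrite /dot_op; split=> [u|u] a x y /=; rewrite !dotE. Qed.

HB.instance Definition _ :=
  bilinear_isBilinear.Build R V V R^o _ _ dot_op dot_is_bilinear.

Lemma dot_continuous : continuous (fun p : V * V => dot p.1 p.2 : R^o).
Proof.
have -> : (fun p : V * V => dot p.1 p.2 : R^o) =
    (\sum_i ((fun p : V * V => p.1 0 i : R) * (fun p : V * V => p.2 0 i : R))).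
  by apply/funext => p; rewrite fct_sumE.
move=> p; apply: differentiable_continuous; apply: differentiable_sum => i.
apply: differentiableM.
  apply: (@differentiable_comp _ _ _ _ fst (fun x : V => x 0 i)).
    by apply: linear_differentiable => y; exact: cvg_fst.
  exact: differentiable_coord.
apply: (@differentiable_comp _ _ _ _ snd (fun x : V => x 0 i)).
  by apply: linear_differentiable => y; exact: cvg_snd.
exact: differentiable_coord.
Qed.

Lemma has_deriv_dot {W : normedModType R} (f g : W -> V) x v a b :
  has_deriv f x v a -> has_deriv g x v b ->
  has_deriv (fun y => dot (f y) (g y) : R^o) x v (dot a (g x) + dot (f x) b).
Proof. exact: (has_deriv_bilin (B := dot_op)) dot_continuous. Qed.

Lemma smoothn_dot {W : normedModType R} n (U : set W) (f g : W -> V) :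
  open U -> smoothn n U f -> smoothn n U g ->
  smoothn n U (fun x => dot (f x) (g x) : R^o).
Proof. by move=> oU; exact: (smoothn_bilin (B := dot_op)) dot_continuous. Qed.

(** * The inverse Euclidean norm *)

Definition inorm (x : V) : R^o := (Num.sqrt (dot x x))^-1.

Lemma inorm_sqr (x : V) : x != 0 -> inorm x ^+ 2 = (dot x x)^-1.
Proof. by rewrite -dot_gt0 => x0; rewrite exprVn sqr_sqrtr // ltW. Qed.

Lemma inorm_sphere (p : V) : unit_sphere p -> inorm p = 1.
Proof. by rewrite /inorm => ->; rewrite sqrtr1 invr1. Qed.

Lemma open_neq0 : open [set x : V | x != 0]%classic.
Proof.
have -> : [set x : V | x != 0]%classic = (~` [set 0])%classic.
  by apply/seteqP; split=> x /= /eqP.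
apply: closed_openC; apply: accessible_closed_set1; exact: hausdorff_accessible.
Qed.

Lemma sphere_neq0 (p : V) : unit_sphere p -> p != 0.
Proof. by rewrite -dot_gt0 => ->. Qed.

Lemma has_deriv_inorm (x v : V) : x != 0 ->
  has_deriv inorm x v (- (inorm x ^+ 3 * dot x v)).
Proof.
move=> x0; have q0 : 0 < dot x x by rewrite dot_gt0.
(* Away from the origin [inorm] is exp (- ln (dot x x) / 2), which the chain rule handles. *)
pose h (s : R) : R^o := expR (- 2^-1 * ln s).
have inormE y : y != 0 -> h (dot y y) = inorm y.
  rewrite -dot_gt0 => y0; rewrite /h /inorm -powR12_sqrt ?ltW // -powRN.
  by rewrite /powR gt_eqF.
apply: (@has_deriv_near _ _ _ (fun y => h (dot y y))).
  by apply: filterS (open_nbhs_nbhs (conj open_neq0 x0)) => y; exact: inormE.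
have dq : has_deriv (fun y => dot y y : R^o) x v (dot v x + dot x v).
  by apply: has_deriv_dot; exact: has_deriv_id.
have dh : is_derive (dot x x) 1 h (- 2^-1 * (dot x x)^-1 * inorm x).
  rewrite -(inormE _ x0) mulrC.
  apply: (@is_derive1_comp _ expR (fun s => - 2^-1 * ln s)).
  by have := @is_deriveZ _ _ R^o (@ln R) (- 2^-1) _ _ _ (is_derive1_ln q0).
have := has_deriv_comp (f := fun y => dot y y) dh dq.
congr has_deriv.
rewrite -inorm_sqr // (dotC v) /GRing.scale /=.
by field.
Qed.

(** Each derivative of [inorm] is a polynomial in [inorm] and a linear function, so smoothness of
    order [n] bootstraps to the next order. *)
Lemma smoothn_inorm n : smoothn n [set x : V | x != 0]%classic inorm.
Proof.
have oU := open_neq0; elim: n => [|n IH].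
  by split=> // x x0; have [] := has_deriv_inorm 0 x0.
apply: (smoothnS (f' := fun v x => (- (inorm x ^+ 2 * dot x v)) *: inorm x)).
- exact: oU.
- move=> x v x0; have := has_deriv_inorm v x0; congr has_deriv.
  by rewrite /GRing.scale /=; ring.
move=> v; apply: smoothnZ => //.
apply: (@smoothn_eq _ _ _ n _
  (fun x => (-1 : R^o) *: (inorm x *: (inorm x *: (dot x v : R^o))))) => //.
  by move=> x _; rewrite /GRing.scale /=; ring.
do ![apply: smoothnZ => //]; first exact: smoothn_cst.
by apply: smoothn_dot => //; [exact: smoothn_id|exact: smoothn_cst].
Qed.

End Euclid.

(** * Calculus on the sphere *)

Section SphereCalculus.
Set Implicit Arguments.
Unset Strict Implicit.
Context {R : realType} {d : nat}.
Local Notation V := 'rV[R]_d.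

(** The radial retraction onto the sphere; [ray_ext f] unfolds to [f] composed with it. *)
Definition nu (x : V) : V := inorm x *: x.

Lemma nu_sphere (x : V) : x != 0 -> unit_sphere (nu x).
Proof.
move=> x0; rewrite /unit_sphere /= !dotE mulrA -expr2 inorm_sqr // mulVf //.
by rewrite dot_eq0.
Qed.

Lemma nu_id (p : V) : unit_sphere p -> nu p = p.
Proof. by move=> Sp; rewrite /nu inorm_sphere // scale1r. Qed.

(** In a tangent direction the norm is stationary, so the retraction differentiates to the
    identity. *)
Lemma has_deriv_nu (p v : V) :
  unit_sphere p -> tangent p v -> has_deriv nu p v v.
Proof.
move=> Sp tv.
have := has_derivZ (has_deriv_inorm v (sphere_neq0 Sp)) (has_deriv_id p v).
congr has_deriv.
by rewrite tv inorm_sphere // mulr0 oppr0 scale0r add0r scale1r.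
Qed.

Lemma smoothn_nu n : smoothn n [set x : V | x != 0]%classic nu.
Proof.
have oU := @open_neq0 R d.
by apply: smoothnZ => //; [exact: smoothn_inorm|exact: smoothn_id].
Qed.

(** This allows derivatives and brackets on the sphere to be computed from ambient formulas, without
    the retraction. *)
Lemma has_deriv_ray {W : normedModType R} (f : V -> W) (p v : V) w :
  unit_sphere p -> tangent p v -> has_deriv f p v w ->
  has_deriv (ray_ext f) p v w.
Proof.
move=> Sp tv [df <-]; have [dn Dn] := has_deriv_nu Sp tv.
have df' : differentiable f (nu p) by rewrite nu_id.
have dfn : differentiable (f \o nu) p by exact: differentiable_comp.
split=> //; rewrite [LHS](deriveE _ dfn) diff_comp //= -(deriveE _ dn) Dn.
by rewrite nu_id // deriveE.
Qed.

Lemma derE {W : normedModType R} (X : V -> V) (f : V -> W) (p : V) w :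
  unit_sphere p -> tangent p (X p) -> has_deriv f p (X p) w -> der X f p = w.
Proof. by move=> Sp tX /(has_deriv_ray Sp tX)[]. Qed.

Lemma der_lin (X : V -> V) (B : {linear V -> V}) p :
  unit_sphere p -> tangent p (X p) -> der X B p = B (X p).
Proof.
move=> Sp tX; apply: derE => //.
by apply: has_deriv_linear; exact: has_deriv_id.
Qed.

Lemma der_eq {W : normedModType R} (X X' : V -> V) (f g : V -> W) (p : V) :
  unit_sphere p -> X p = X' p -> (forall q, unit_sphere q -> f q = g q) ->
  der X f p = der X' g p.
Proof.
move=> Sp XX fg; rewrite /der XX; apply: near_eq_derive.
apply: filterS (open_nbhs_nbhs (conj open_neq0 (sphere_neq0 Sp))) => x x0.
exact/fg/nu_sphere.
Qed.

Lemma bracket_eq (X X' Y Y' : V -> V) p : unit_sphere p ->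
  (forall q, unit_sphere q -> X q = X' q) ->
  (forall q, unit_sphere q -> Y q = Y' q) -> bracket X Y p = bracket X' Y' p.
Proof.
move=> Sp XX YY; rewrite /bracket (der_eq Sp (XX p Sp) YY).
by rewrite (der_eq Sp (YY p Sp) XX).
Qed.

Lemma vector_field_has_deriv (X Y : V -> V) p : vector_field Y ->
  unit_sphere p -> has_deriv (ray_ext Y) p (X p) (der X Y p).
Proof.
by move=> [sY _] Sp; split=> //; exact: (sY [::] p (sphere_neq0 Sp)).
Qed.

Lemma ray_ext_id (T : Type) (f : V -> T) p : unit_sphere p -> ray_ext f p = f p.
Proof. by move=> Sp; rewrite -[LHS]/(f (nu p)) nu_id. Qed.

Lemma vector_fieldI (X : V -> V) :
  (forall n, smoothn n [set x : V | x != 0]%classic (fun x => X (nu x))) ->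
  (forall p, unit_sphere p -> tangent p (X p)) -> vector_field X.
Proof. by move=> sX tX; split=> //; apply/smooth_onP. Qed.

Lemma linear_vector_field (B : {linear V -> V}) :
  (forall u v, dot (B u) v = - dot u (B v)) -> vector_field B.
Proof.
move=> Ba; apply: vector_fieldI => [n|p _].
  by apply: smoothn_linear; [exact: open_neq0|exact: smoothn_nu].
by rewrite /tangent; have := Ba p p; rewrite (dotC (B p)); lra.
Qed.

(* the tangential projection of a constant vector takes any tangent value *)
Lemma vector_field_through (p w : V) : unit_sphere p -> tangent p w ->
  exists2 X : V -> V, vector_field X & X p = w.
Proof.
move=> Sp tw; exists (fun q => w - dot w q *: q).
  have oU := @open_neq0 R d.
  apply: vector_fieldI => [n|q Sq].
    have sn := @smoothn_nu n; have sw := smoothn_cst n w oU.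
    by apply: smoothnB => //; apply: smoothnZ => //; exact: smoothn_dot.
  by rewrite /tangent !dotE Sq (dotC q); ring.
by rewrite dotC tw scale0r subr0.
Qed.

End SphereCalculus.

(** * The sheared K-contact metrics *)

Section Deformation.
Set Implicit Arguments.
Unset Strict Implicit.
Context {R : realType} {d : nat}.
Local Notation V := 'rV[R]_d.
Context (J P1 P2 A : {linear V -> V}).
Context (Jskew : forall u v, dot (J u) v = - dot u (J v))
        (JJ : forall u, J (J u) = - u).
Context (P1sym : forall u v, dot (P1 u) v = dot u (P1 v))
        (P2sym : forall u v, dot (P2 u) v = dot u (P2 v))
        (P11 : forall u, P1 (P1 u) = P1 u) (P22 : forall u, P2 (P2 u) = P2 u)
        (P12 : forall u, P1 (P2 u) = 0) (P21 : forall u, P2 (P1 u) = 0)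
        (P1J : forall u, P1 (J u) = J (P1 u))
        (P2J : forall u, P2 (J u) = J (P2 u)).

Definition sq1 (q : V) : R^o := dot (P1 q) (P1 q).
Definition sq2 (q : V) : R^o := dot (P2 q) (P2 q).
(* Locked because its unfolding, a sum, would be matched by [dotE]. *)
Definition va (q : V) : V := locked (sq1 q *: P2 q - sq2 q *: P1 q).
Lemma vaE q : va q = sq1 q *: P2 q - sq2 q *: P1 q.
Proof. by rewrite /va -lock. Qed.
Definition vb (q : V) : V := J (va q).
(* [shear t q] only moves the plane spanned by [va q] and [vb q], where it has
   determinant 1; it therefore preserves [(u, v) |-> dot (J u) v], which keeps
   the deformed structure K-contact with the same contact form. *)
Definition shear (t : R^o) (q u : V) : V := u + (t * dot (vb q) u) *: va q.
Definition gdef (t : R) (q u v : V) : R := dot (shear t q u) (shear t q v).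
(* the tangential part of [J u], for [q] on the sphere *)
Definition Jtan (q u : V) : V := J u + dot u (J q) *: q.
Definition phidef (t : R) (q u : V) : V :=
  shear (- t) q (Jtan q (shear t q u)).

Lemma dotJ (u : V) : dot u (J u) = 0.
Proof. have := Jskew u u; rewrite (dotC (J u)); lra. Qed.

Lemma dotJJ (u v : V) : dot (J u) (J v) = dot u v.
Proof. by rewrite Jskew JJ dotNr opprK. Qed.

Lemma dotJC (u v : V) : dot u (J v) = - dot (J u) v.
Proof. by rewrite Jskew opprK. Qed.

Lemma dotP1 q : dot (P1 q) q = sq1 q. Proof. by rewrite /sq1 -P1sym P11. Qed.
Lemma dotP2 q : dot (P2 q) q = sq2 q. Proof. by rewrite /sq2 -P2sym P22. Qed.

Lemma dotP1J q : dot (P1 q) (J q) = 0.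
Proof. by rewrite -P11 P1sym P1J dotJ. Qed.
Lemma dotP2J q : dot (P2 q) (J q) = 0.
Proof. by rewrite -P22 P2sym P2J dotJ. Qed.

Lemma va_dot q : dot (va q) q = 0.
Proof. by rewrite vaE !dotE dotP1 dotP2; ring. Qed.

Lemma va_dotJ q : dot (va q) (J q) = 0.
Proof. by rewrite vaE !dotE dotP1J dotP2J; ring. Qed.

Lemma vb_dot q : dot (vb q) q = 0.
Proof. by rewrite /vb Jskew va_dotJ oppr0. Qed.

Lemma vb_dotJ q : dot (vb q) (J q) = 0.
Proof. by rewrite /vb dotJJ va_dot. Qed.

Lemma vb_dot_va q : dot (vb q) (va q) = 0.
Proof. by rewrite /vb Jskew dotJ oppr0. Qed.

(** As [va q] and [vb q] are orthogonal, [shear t q] is the identity plus t times a map of square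
    zero. *)
Lemma shearK t q : cancel (shear t q) (shear (- t) q).
Proof.
move=> u; rewrite /shear !dotE vb_dot_va; apply/rowP => i; rewrite !mxE; ring.
Qed.

Lemma shearKN t q : cancel (shear (- t) q) (shear t q).
Proof. by move=> u; rewrite -{1}[t]opprK shearK. Qed.

Lemma shearD t q u v : shear t q (u + v) = shear t q u + shear t q v.
Proof. by rewrite /shear !dotE; apply/rowP => i; rewrite !mxE; ring. Qed.

Lemma shearZ t q k u : shear t q (k *: u) = k *: shear t q u.
Proof. by rewrite /shear !dotE; apply/rowP => i; rewrite !mxE; ring. Qed.

Lemma shearN t q u : shear t q (- u) = - shear t q u.
Proof. by rewrite -scaleN1r shearZ scaleN1r. Qed.

Lemma shearJ t q : shear t q (J q) = J q.
Proof. by rewrite /shear vb_dotJ mulr0 scale0r addr0. Qed.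

Lemma shear_dot t q u : dot (shear t q u) q = dot u q.
Proof. by rewrite /shear !dotE va_dot; ring. Qed.

Lemma shear_dotJ t q u : dot (shear t q u) (J q) = dot u (J q).
Proof. by rewrite /shear !dotE va_dotJ; ring. Qed.

Lemma gdefC t q u v : gdef t q u v = gdef t q v u.
Proof. exact: dotC. Qed.

Lemma gdefDl t q u v w : gdef t q (u + v) w = gdef t q u w + gdef t q v w.
Proof. by rewrite /gdef shearD dotDl. Qed.

Lemma gdefZl t q k u w : gdef t q (k *: u) w = k * gdef t q u w.
Proof. by rewrite /gdef shearZ dotZl. Qed.

Lemma gdef_gt0 t q u : (0 < gdef t q u u) = (u != 0).
Proof.
rewrite /gdef dot_gt0; congr (~~ _); apply/eqP/eqP => [u0|->].
  by rewrite -[u](shearK t q) u0 /shear dot0r mulr0 scale0r addr0.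
by rewrite /shear dot0r mulr0 scale0r addr0.
Qed.

(** The shear fixes [J q] and moves other vectors along [va q], which is orthogonal to [J q]. Hence
    the contact form is the round one for every [t]. *)
Lemma gdefJ t q u : gdef t q (J q) u = dot (J q) u.
Proof. by rewrite /gdef shearJ dotC shear_dotJ dotC. Qed.

Lemma phidef_tangent t q u : unit_sphere q -> tangent q u ->
  tangent q (phidef t q u).
Proof.
move=> Sq tu; rewrite /tangent /phidef dotC shear_dot /Jtan.
by move: (shear t q u) => w; rewrite !dotE Jskew Sq mulr1 addNr.
Qed.

(** Once the outer shear of [phidef] is cancelled, what remains is that the shear preserves dot (J
    u) v: the two terms linear in t cancel, and the quadratic one contains dot (vb q) (va q) = 0. *)
Lemma gdef_phi t q u v : unit_sphere q -> tangent q v ->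
  gdef t q (phidef t q u) v = dot (J u) v.
Proof.
move=> Sq tv; rewrite /gdef /phidef shearKN /Jtan dotDl dotZl.
rewrite (dotC q) shear_dot dotC (dotC v) tv mulr0 addr0.
rewrite /shear linearD linearZ /= -/(vb q) !dotE.
rewrite (dotJC (va q)) -/(vb q) (dotC (va q) (vb q)) vb_dot_va.
by rewrite (dotC v (vb q)) (dotC (J u)); ring.
Qed.

(** [phidef] is conjugate by the shear to [Jtan], which on tangent vectors squares to minus the
    identity plus the projection on [J q], a vector fixed by the shear. *)
Lemma phidef_sqr t q u : unit_sphere q -> tangent q u ->
  phidef t q (phidef t q u) = - u + gdef t q (J q) u *: J q.
Proof.
move=> Sq tu; rewrite gdefJ /phidef shearKN.
have -> : Jtan q (Jtan q (shear t q u)) = - shear t q u + dot (J q) u *: J q.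
  have := shear_dot t q u; have := shear_dotJ t q u.
  rewrite (dotC u q) tu (dotC u).
  move: (shear t q u) => w wJ wq.
  rewrite /Jtan linearD linearZ /= JJ !dotE dotJJ dotJ wJ wq.
  by apply/rowP => i; rewrite !mxE; ring.
by rewrite shearD shearN shearZ shearK shearJ.
Qed.

(** * Derivatives and smoothness of the shear *)

Definition dva (p v : V) : V :=
  (dot (P1 v) (P1 p) + dot (P1 p) (P1 v)) *: P2 p + sq1 p *: P2 v
  - ((dot (P2 v) (P2 p) + dot (P2 p) (P2 v)) *: P1 p + sq2 p *: P1 v).

Lemma has_deriv_va p v : has_deriv va p v (dva p v).
Proof.
have -> : va = fun q => sq1 q *: P2 q - sq2 q *: P1 q.
  by apply/funext => q; rewrite vaE.
have dP (P : {linear V -> V}) : has_deriv P p v (P v).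
  by apply: has_deriv_linear; exact: has_deriv_id.
by apply: has_derivB; apply: has_derivZ => //; exact: has_deriv_dot.
Qed.

Lemma smoothn_sq1 {W : normedModType R} n (U : set W) (q : W -> V) :
  open U -> smoothn n U q -> smoothn n U (fun y => sq1 (q y)).
Proof. by move=> oU sq; apply: smoothn_dot => //; exact: smoothn_linear. Qed.

Lemma smoothn_sq2 {W : normedModType R} n (U : set W) (q : W -> V) :
  open U -> smoothn n U q -> smoothn n U (fun y => sq2 (q y)).
Proof. by move=> oU sq; apply: smoothn_dot => //; exact: smoothn_linear. Qed.

Lemma smoothn_va {W : normedModType R} n (U : set W) (q : W -> V) :
  open U -> smoothn n U q -> smoothn n U (fun y => va (q y)).
Proof.
move=> oU sq.
apply: (@smoothn_eq _ _ _ n U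
  (fun y => sq1 (q y) *: P2 (q y) - sq2 (q y) *: P1 (q y))) => //.
  by move=> x _; rewrite vaE.
by apply: smoothnB => //; apply: smoothnZ => //;
  [exact: smoothn_sq1|exact: smoothn_linear|exact: smoothn_sq2|
   exact: smoothn_linear].
Qed.

Lemma smoothn_shear {W : normedModType R} n (U : set W) (t : W -> R^o)
    (q u : W -> V) : open U ->
  smoothn n U t -> smoothn n U q -> smoothn n U u ->
  smoothn n U (fun y => shear (t y) (q y) (u y)).
Proof.
move=> oU st sq su; have sa := smoothn_va oU sq.
apply: smoothnD => //; apply: smoothnZ => //.
apply: (smoothnZ (f := fun y => dot (vb (q y)) (u y) : R^o)) => //.
by apply: smoothn_dot => //; exact: smoothn_linear.
Qed.

Lemma smooth_gdef t (X Y : V -> V) :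
  vector_field X -> vector_field Y -> smooth_map (ip (gdef t) X Y).
Proof.
move=> [/smooth_onP sX _] [/smooth_onP sY _]; apply/smooth_onP => n.
have oU := @open_neq0 R d.
by apply: smoothn_dot => //; apply: smoothn_shear => //; try exact: smoothn_nu;
  exact: smoothn_cst.
Qed.

Lemma gdef_riemannian t : riemannian_metric (gdef t).
Proof.
split.
- by move=> p _ k u v w _ _ _; rewrite gdefDl gdefZl.
- by move=> p _ u v _ _; exact: gdefC.
- by move=> p _ u _ u0; rewrite gdef_gt0.
- by move=> X Y vX vY; exact: smooth_gdef.
Qed.

(** The product rule for [shear t q (Y q)] at [p] in direction [v], with [u] the value of the field
    [Y] at [p] and [u'] its derivative. *)
Definition dshear (t : R) (p v u u' : V) : V :=
  u' + ((t * (dot (J (dva p v)) u + dot (vb p) u')) *: va p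
        + (t * dot (vb p) u) *: dva p v).

Lemma der_gdef t (X Y Z : V -> V) p :
  unit_sphere p -> tangent p (X p) -> vector_field Y -> vector_field Z ->
  der X (ip (gdef t) Y Z) p =
    dot (dshear t p (X p) (Y p) (der X Y p)) (shear t p (Z p))
    + dot (shear t p (Y p)) (dshear t p (X p) (Z p) (der X Z p)).
Proof.
move=> Sp tX vY vZ; have dn := has_deriv_nu Sp tX.
have da : has_deriv (ray_ext va) p (X p) (dva p (X p)).
  by apply: has_deriv_ray => //; exact: has_deriv_va.
have dF (W : V -> V) : vector_field W ->
    has_deriv (fun x => shear t (nu x) (ray_ext W x)) p (X p)
              (dshear t p (X p) (W p) (der X W p)).
  move=> vW; have dW := vector_field_has_deriv X vW Sp.
  rewrite /dshear; apply: has_derivD => //.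
  have := has_derivZ (has_derivZ (has_deriv_cst (t : R^o) p (X p))
    (has_deriv_dot (has_deriv_linear J da) dW)) da.
  congr has_deriv; rewrite !ray_ext_id // /GRing.scale /=.
  by rewrite mul0r add0r.
have [_] := has_deriv_dot (dF _ vY) (dF _ vZ).
by rewrite !nu_id // !ray_ext_id.
Qed.

(** The two conditions on [va] say that the flow of [B] carries [va] and [vb] to themselves, hence
    commutes with the shear. So differentiating a sheared field [W] along [B] gives the sheared
    bracket plus [B] applied to the sheared field, and skewness cancels the latter terms in the
    metric. *)
Lemma killing_linear t (B : {linear V -> V}) :
  (forall u v, dot (B u) v = - dot u (B v)) ->
  (forall p, dva p (B p) = B (va p)) ->
  (forall p, J (B (va p)) = B (vb p)) -> killing (gdef t) B.
Proof.
move=> Bskew Bva Bvb; have vB := linear_vector_field Bskew.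
split=> // Y Z vY vZ p Sp; have tB : tangent p (B p) by case: vB => _; apply.
rewrite der_gdef // /ip /gdef.
have FE (W : V -> V) : vector_field W ->
    dshear t p (B p) (W p) (der B W p)
    = shear t p (bracket B W p) + B (shear t p (W p)).
  move=> [_ tW]; rewrite /bracket (der_lin B Sp (tW _ Sp)) /dshear Bva Bvb.
  rewrite /shear !dotE Bskew linearD linearZ /=.
  by apply/rowP => i; rewrite !mxE; ring.
by rewrite !FE // dotDl dotDr Bskew; ring.
Qed.

(** * The K-contact structure *)

Lemma va_J p : dva p (J p) = J (va p).
Proof.
rewrite vaE /dva P1J P2J dotJ dotC dotJ (dotC (J _)) dotJ addr0 !scale0r !add0r.
by rewrite linearB !linearZ.
Qed.

Lemma killing_J t : killing (gdef t) J.
Proof. by apply: killing_linear => // p; exact: va_J. Qed.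

Lemma der_contact t (X Y : V -> V) p :
  unit_sphere p -> vector_field X -> vector_field Y ->
  der X (ip (gdef t) J Y) p = dot (J (X p)) (Y p) + dot (J p) (der X Y p).
Proof.
move=> Sp [_ tX] vY.
have -> : ip (gdef t) J Y = (fun q => dot (J q) (Y q)).
  by apply/funext => q; rewrite /ip gdefJ.
have [_] := has_deriv_dot (has_deriv_linear J (has_deriv_nu Sp (tX p Sp)))
  (vector_field_has_deriv X vY Sp).
by rewrite nu_id // ray_ext_id.
Qed.

(** By [gdefJ] the form is dot (J q) for all [t], and its exterior derivative is computed in the
    flat ambient space. *)
Lemma d_dual_J t (X Y : V -> V) p :
  unit_sphere p -> vector_field X -> vector_field Y ->
  d_dual (gdef t) J X Y p = 2 * dot (J (X p)) (Y p).
Proof.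
move=> Sp vX vY; rewrite /d_dual !der_contact // /ip gdefJ /bracket !dotE.
rewrite (dotC (J (Y p))) dotJC.
move: (dot (J (X p)) _) (dot (J p) _) (dot (J p) (der Y X p)) => x y z.
by ring.
Qed.

Lemma k_contact_gdef t : k_contact (gdef t) J.
Proof.
split; first exact: gdef_riemannian.
  split; first exact: killing_J.
  by move=> p Sp; rewrite /length /ip gdefJ dotJJ Sp sqrtr1.
exists (phidef t); split.
- by move=> p v; exact: phidef_tangent.
- move=> X Y vX vY p Sp; have /(_ p Sp) tY := vY.2.
  rewrite d_dual_J // gdef_phi //.
  by rewrite mulKf // pnatr_eq0.
- by move=> p v; exact: phidef_sqr.
Qed.

(** * The rotation [A] as a Killing field in the second component *)

Context (Askew : forall u v, dot (A u) v = - dot u (A v))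
        (AJ : forall u, A (J u) = - J (A u))
        (AP1 : forall u, A (P1 u) = 0) (AP2 : forall u, A (P2 u) = 0)
        (P1A : forall u, P1 (A u) = 0) (P2A : forall u, P2 (A u) = 0).

Lemma A_va p : A (va p) = 0.
Proof.
by rewrite vaE linearB !linearZ /= AP1 AP2 scaler0 oppr0 scaler0 addr0.
Qed.

Lemma g2_A t : g2_component (gdef t) J A.
Proof.
have tan (B : {linear V -> V}) p : (forall u v, dot (B u) v = - dot u (B v)) ->
    unit_sphere p -> tangent p (B p).
  by move=> Bs; case: (linear_vector_field Bs) => _; apply.
split.
  apply: killing_linear => // p; rewrite ?A_va.
    by rewrite /dva P1A P2A !dot0l !dot0r !(scaler0, addr0) !scale0r subrr.
  by rewrite /vb AJ A_va !linear0.
(* For linear fields the bracket is the reversed commutator: [J, A] = A J - J A = -2 J A by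
   anticommutation, and bracketing with [J] once more gives 4 J J A = -4 A. *)
move=> p Sp; pose B : {linear V -> V} := (-2 : R) \*: (J \o A).
have -> : bracket J (bracket J A) p = bracket J B p.
  apply: bracket_eq => // q Sq; rewrite /bracket !der_lin //; try exact: tan.
  by rewrite AJ /B /=; apply/rowP => i; rewrite !mxE; ring.
rewrite /bracket !der_lin //; try exact: tan; first last.
  apply: tan => // u v; rewrite /B /= !dotE Jskew Askew AJ !dotE; ring.
rewrite /B /= AJ linearN linearZ /= !JJ; apply/rowP => i; rewrite !mxE; ring.
Qed.

Lemma length_A t p : length (gdef t) A p = Num.sqrt (dot (A p) (A p)).
Proof.
have Ab : dot (vb p) (A p) = 0.
  by rewrite -[LHS]opprK -Askew /vb AJ A_va linear0 oppr0 dot0l oppr0.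
by rewrite /length /ip /gdef /shear Ab mulr0 scale0r addr0.
Qed.

(** * The Levi-Civita connection and the Nijenhuis tensor *)

Lemma nabla_J t nabla (X : V -> V) p : levi_civita (gdef t) nabla ->
  unit_sphere p -> vector_field X -> nabla X J p = phidef t p (X p).
Proof.
move=> [[vn _ _] tor met] Sp vX; have vJ := linear_vector_field Jskew.
have tX : tangent p (X p) by case: vX => _; apply.
(* The Killing equation makes g (nabla_X J, Z) skew in X and Z, and torsion-freeness identifies the
   exterior derivative of the contact form with twice this skew form. *)
have sk Z : vector_field Z ->
    ip (gdef t) (nabla X J) Z p = dot (J (X p)) (Z p).
  move=> vZ; have [_ /(_ X Z vX vZ p Sp) kJ] := killing_J t.
  have dJ := d_dual_J t Sp vX vZ; rewrite /d_dual !met // in dJ kJ *.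
  have gl u v w : gdef t p (u - v) w = gdef t p u w - gdef t p v w.
    by rewrite -scaleN1r gdefDl gdefZl mulN1r.
  have gr u v w : gdef t p w (u - v) = gdef t p w u - gdef t p w v.
    by rewrite gdefC gl !(gdefC _ _ w).
  have e1 := gr (nabla X Z p) (nabla Z X p) (J p).
  have e2 := gl (nabla J X p) (nabla X J p) (Z p).
  have e3 := gr (nabla J Z p) (nabla Z J p) (X p).
  have e4 := gdefC t p (X p) (nabla Z J p).
  rewrite !tor // in e1 e2 e3; move: dJ kJ e1 e2 e3 e4; rewrite /ip.
  (* All identities are linear in the values of the metric, which become atoms for [lra]. *)
  repeat match goal with
    |- context[gdef ?a ?b ?c ?d] => generalize (gdef a b c d); intro end.
  by generalize (dot (J (X p)) (Z p)); intros; lra.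
(* Nondegeneracy: the difference of the two sides is the value at [p] of some field [Z], and testing
   against [Z] shows that its norm vanishes. *)
have tw : tangent p (nabla X J p - phidef t p (X p)).
  have /(_ p Sp) tn := (vn X J vX vJ).2.
  have := phidef_tangent t Sp tX; rewrite /tangent in tn * => tp.
  by rewrite dotDr dotNr tn tp subrr.
have [Z vZ Zp] := vector_field_through Sp tw.
have := sk Z vZ; rewrite /ip -(gdef_phi t (X p) Sp); last by rewrite Zp.
move/eqP; rewrite -subr_eq0 -mulN1r -gdefZl -gdefDl scaleN1r Zp.
move/eqP => g0; apply/eqP; rewrite -subr_eq0; apply: contraT => nz.
by move: nz; rewrite -(gdef_gt0 t p) g0 ltxx.
Qed.

Lemma phidefD t q u v : phidef t q (u + v) = phidef t q u + phidef t q v.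
Proof.
rewrite /phidef shearD; move: (shear t q u) (shear t q v) => x y.
by rewrite -shearD /Jtan linearD dotDl scalerDl addrACA.
Qed.

Lemma phidefZ t q k u : phidef t q (k *: u) = k *: phidef t q u.
Proof.
rewrite /phidef shearZ; move: (shear t q u) => x.
by rewrite -shearZ /Jtan linearZ dotZl scalerDr scalerA.
Qed.

Lemma phidefB t q u v : phidef t q (u - v) = phidef t q u - phidef t q v.
Proof. by rewrite -scaleN1r phidefD phidefZ scaleN1r. Qed.

(* Normality of a Sasakian structure, i.e. the vanishing of the Nijenhuis tensor
   of [phi] modulo [xi], composed with [phi]. *)
Lemma sasakian_nijenhuis t nabla (X Y : V -> V) p :
  levi_civita (gdef t) nabla ->
  (forall X Y, vector_field X -> vector_field Y ->
   forall p, unit_sphere p ->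
     nabla X (nabla Y J) p - nabla (nabla X Y) J p
     = ip (gdef t) J Y p *: X p - ip (gdef t) X Y p *: J p) ->
  unit_sphere p -> vector_field X -> vector_field Y ->
  dot (J p) (X p) = 0 -> dot (J p) (Y p) = 0 ->
  gdef t p (X p) (Y p) = 0 -> dot (J (X p)) (Y p) = 0 ->
  bracket (nabla X J) (nabla Y J) p =
  phidef t p (bracket (nabla X J) Y p + bracket X (nabla Y J) p
              - phidef t p (bracket X Y p)).
Proof.
move=> LC sas Sp vX vY JX JY XY JXY.
have vJ := linear_vector_field Jskew.
have [[vn _ _] tor met] := LC.
have vX' := vn X J vX vJ; have vY' := vn Y J vY vJ.
have nJ Z : vector_field Z -> nabla Z J p = phidef t p (Z p) by exact: nabla_J.
have JX' : ip (gdef t) (nabla X J) Y p = 0.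
  by rewrite /ip nJ // gdef_phi //; case: vY => _; apply.
have JY' : ip (gdef t) (nabla Y J) X p = 0.
  rewrite /ip nJ // gdef_phi //; last by case: vX => _; apply.
  by rewrite dotC dotJC JXY oppr0.
have JXp : ip (gdef t) J X p = 0 by rewrite /ip gdefJ.
have JYp : ip (gdef t) J Y p = 0 by rewrite /ip gdefJ.
have XYp : ip (gdef t) X Y p = 0 by [].
have YXp : ip (gdef t) Y X p = 0 by rewrite /ip gdefC.
(* Where the right-hand side of the Sasakian identity vanishes, phi commutes with nabla_Z. This is
   applied to the pairs (phi X, Y), (phi Y, X), (Y, X) and (X, Y) after the brackets are expanded by
   torsion-freeness. *)
have sas0 Z T : vector_field Z -> vector_field T ->
    ip (gdef t) J T p = 0 -> ip (gdef t) Z T p = 0 ->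
    nabla Z (nabla T J) p = phidef t p (nabla Z T p).
  move=> vZ vT z1 z2; apply/eqP; rewrite -nJ; last exact: vn.
  by rewrite -subr_eq0 sas // z1 z2 !scale0r subrr.
rewrite -!tor // !sas0 // -!phidefB; congr (phidef t p _).
by rewrite phidefB; apply/rowP => i; rewrite !mxE; ring.
Qed.

(** * The test fields [va] and [vy] *)

Definition sqQ (q : V) : R^o := sq1 q + sq2 q.
(** On the sphere, minus the tangential part of Q q, where Q = P1 + P2. *)
Definition vy (q : V) : V := sqQ q *: q - (P1 q + P2 q).
(* [vc] and [J vy] are the images under [phi] of [va] and [vy]. *)
Definition vc (t : R) (q : V) : V := vb q - (t * dot (va q) (va q)) *: va q.

Definition dsqQ (p v : V) : R^o :=
  2 * (dot (P1 p) (P1 v) + dot (P2 p) (P2 v)).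
Definition dvy (p v : V) : V :=
  dsqQ p v *: p + sqQ p *: v - (P1 v + P2 v).

Lemma has_deriv_vy p v : has_deriv vy p v (dvy p v).
Proof.
have dP (P : {linear V -> V}) : has_deriv P p v (P v).
  by apply: has_deriv_linear; exact: has_deriv_id.
apply: has_derivB; last exact: has_derivD.
apply: has_derivZ; last exact: has_deriv_id.
have := has_derivD (has_deriv_dot (dP P1) (dP P1))
  (has_deriv_dot (dP P2) (dP P2)).
by congr has_deriv; rewrite /dsqQ (dotC (P1 v)) (dotC (P2 v)); ring.
Qed.

Lemma has_deriv_vc t p v : has_deriv (vc t) p v
  (J (dva p v) - ((2 * t * dot (va p) (dva p v)) *: va p +
                  (t * dot (va p) (va p)) *: dva p v)).
Proof.
have da := has_deriv_va p v.
apply: has_derivB; first exact: has_deriv_linear.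
have := has_derivZ (has_derivZ (has_deriv_cst (t : R^o) p v)
  (has_deriv_dot da da)) da.
by congr has_deriv; rewrite scale0r add0r (dotC (dva _ _)) /GRing.scale /=;
  congr (_ *: _ + _); ring.
Qed.

Lemma P1_va p : P1 (va p) = - sq2 p *: P1 p.
Proof.
by rewrite vaE linearB !linearZ /= P12 P11 scaler0 add0r scalerN scaleNr.
Qed.

Lemma P2_va p : P2 (va p) = sq1 p *: P2 p.
Proof. by rewrite vaE linearB !linearZ /= P21 P22 oppr0 !scaler0 addr0. Qed.

(** [va p] lies in the range of Q, and [sqQ] is stationary along it. *)
Lemma dvy_va p : dvy p (va p) = (sqQ p - 1) *: va p.
Proof.
rewrite /dvy /dsqQ P1_va P2_va !dotZr -!/(sq1 p) -!/(sq2 p) vaE.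
by apply/rowP => i; rewrite !mxE; ring.
Qed.

Lemma dvy_vb p : dvy p (vb p) = (sqQ p - 1) *: vb p.
Proof.
rewrite /dvy /dsqQ /vb P1J P2J P1_va P2_va !linearZ /= !dotZr !dotJ vaE.
rewrite linearB !linearZ /=.
by apply/rowP => i; rewrite !mxE; ring.
Qed.

Lemma P1_vy p : P1 (vy p) = (sqQ p - 1) *: P1 p.
Proof.
rewrite /vy linearB linearD linearZ /= P11 P12.
by apply/rowP => i; rewrite !mxE; ring.
Qed.

Lemma P2_vy p : P2 (vy p) = (sqQ p - 1) *: P2 p.
Proof.
rewrite /vy linearB linearD linearZ /= P22 P21.
by apply/rowP => i; rewrite !mxE; ring.
Qed.

(** [va] is a homogeneous cubic in Q q, and Q maps [vy p] to (sqQ p - 1) Q p, so the factor 3 is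
    Euler's. *)
Lemma dva_vy p : dva p (vy p) = (3 * (sqQ p - 1)) *: va p.
Proof.
rewrite /dva P1_vy P2_vy !dotE -!/(sq1 p) -!/(sq2 p) vaE.
by apply/rowP => i; rewrite !mxE; ring.
Qed.

(** Here Q of the direction is (sqQ p - 1) J Q p, an infinitesimal complex rotation, under which
    [va] is equivariant. *)
Lemma dva_Jvy p : dva p (J (vy p)) = (sqQ p - 1) *: vb p.
Proof.
rewrite /dva P1J P2J P1_vy P2_vy !linearZ /= !dotE !(dotC (J _)) !dotJ /vb vaE.
by rewrite linearB !linearZ /=; apply/rowP => i; rewrite !mxE; ring.
Qed.

Lemma dvy_vc t p : dvy p (vc t p) = (sqQ p - 1) *: vc t p.
Proof.
have dvyB u v k : dvy p (u - k *: v) = dvy p u - k *: dvy p v.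
  rewrite /dvy /dsqQ !linearB !linearZ /= !dotE.
  by apply/rowP => i; rewrite !mxE; ring.
by rewrite /vc dvyB dvy_va dvy_vb; apply/rowP => i; rewrite !mxE; ring.
Qed.

Lemma va_vector_field : vector_field va.
Proof.
apply: vector_fieldI => [n|p _]; last by rewrite /tangent dotC va_dot.
by apply: smoothn_va; [exact: open_neq0|exact: smoothn_nu].
Qed.

Lemma vy_dot p : unit_sphere p -> dot p (vy p) = 0.
Proof.
move=> Sp; rewrite /vy !dotE Sp !(dotC p) dotP1 dotP2 /sqQ; ring.
Qed.

Lemma vy_vector_field : vector_field vy.
Proof.
have oU := @open_neq0 R d.
apply: vector_fieldI => [n|p Sp]; last by rewrite /tangent vy_dot.
have sn := @smoothn_nu R d n.
apply: smoothnB => //; last by apply: smoothnD => //; exact: smoothn_linear.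
apply: smoothnZ => //; apply: smoothnD => //; first exact: smoothn_sq1.
exact: smoothn_sq2.
Qed.

Lemma vb_dotvy p : dot (vb p) (vy p) = 0.
Proof.
rewrite /vy !dotE vb_dot -P1sym -P2sym /vb P1J P2J P1_va P2_va !linearZ /=.
by rewrite !dotZl !Jskew dotP1J dotP2J; ring.
Qed.

Lemma va_dotvy p : dot (va p) (vy p) = 0.
Proof.
by rewrite /vy !dotE va_dot -P1sym -P2sym P1_va P2_va !dotE dotP1 dotP2; ring.
Qed.

Lemma Jp_dotvy p : dot (J p) (vy p) = 0.
Proof.
by rewrite /vy !dotE (dotC (J p) p) dotJ !(dotC (J p)) dotP1J dotP2J; ring.
Qed.

Lemma shear_va t p : shear t p (va p) = va p.
Proof. by rewrite /shear vb_dot_va mulr0 scale0r addr0. Qed.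

Lemma shear_vy t p : shear t p (vy p) = vy p.
Proof. by rewrite /shear vb_dotvy mulr0 scale0r addr0. Qed.

Lemma phidef_va t p : phidef t p (va p) = vc t p.
Proof.
rewrite /phidef shear_va /Jtan va_dotJ scale0r addr0 -/(vb p) /shear.
by rewrite {2}/vb dotJJ /vc mulNr scaleNr.
Qed.

Lemma phidef_vy t p : phidef t p (vy p) = J (vy p).
Proof.
rewrite /phidef shear_vy /Jtan (dotC (vy p)) Jp_dotvy scale0r addr0 /shear.
by rewrite /vb dotJJ va_dotvy mulr0 scale0r addr0.
Qed.

Lemma not_sasakian (t : R) p :
  t != 0 -> unit_sphere p -> va p != 0 -> sqQ p != 1 ->
  ~ sasakian (gdef t) J.
Proof.
move=> t0 Sp a0 Q1 [_ _ [nabla [LC sas]]].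
have va' := va_vector_field; have vy' := vy_vector_field.
have := sasakian_nijenhuis LC sas Sp va' vy'.
rewrite dotC va_dotJ Jp_dotvy /gdef shear_va shear_vy va_dotvy -/(vb p).
rewrite vb_dotvy.
move=> /(_ erefl erefl erefl erefl).
have nva q : unit_sphere q -> nabla va J q = vc t q.
  by move=> Sq; rewrite (nabla_J LC Sq va') phidef_va.
have nvy q : unit_sphere q -> nabla vy J q = J (vy q).
  by move=> Sq; rewrite (nabla_J LC Sq vy') phidef_vy.
(* Brackets involve derivatives, so the covariant derivatives are replaced by explicit fields on the
   whole sphere and not only at [p]. *)
rewrite (bracket_eq Sp nva nvy) (bracket_eq Sp nva (fun _ _ => erefl)).
rewrite (bracket_eq Sp (fun _ _ => erefl) nvy) /bracket.
have ta : tangent p (va p) by case: va' => _; apply.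
have ty : tangent p (vy p) by case: vy' => _; apply.
have tc : tangent p (vc t p) by rewrite -phidef_va; exact: phidef_tangent.
have tJy : tangent p (J (vy p)).
  by rewrite -(phidef_vy t); exact: phidef_tangent.
have dy v := has_deriv_vy p v; have dJy v := has_deriv_linear J (dy v).
rewrite !(derE Sp _ (dy _)) // !(derE Sp _ (dJy _)) //.
rewrite !(derE Sp _ (has_deriv_va p _)) //.
rewrite !(derE Sp _ (has_deriv_vc t p _)) //.
rewrite dvy_va dvy_vc dva_vy dva_Jvy.
(* The left-hand side [phi a, phi Y] vanishes. *)
have -> : J ((sqQ p - 1) *: vc t p) - (J ((sqQ p - 1) *: vb p) -
    ((2 * t * dot (va p) ((sqQ p - 1) *: vb p)) *: va p +
    (t * dot (va p) (va p)) *: ((sqQ p - 1) *: vb p))) = 0.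
  have Jc : J (vc t p) = J (vb p) - (t * dot (va p) (va p)) *: vb p.
    by rewrite /vc linearB [J (_ *: _)]linearZ.
  rewrite dotZr (dotC (va p) (vb p)) vb_dot_va !linearZ /= Jc.
  apply/rowP => i; rewrite !mxE; ring.
rewrite -scalerBl phidefZ phidef_va ![J (_ *: va p)]linearZ /= -/(vb p) dotZr.
set m := dot (va p) (va p); set k := sqQ p - 1.
set w := (X in phidef t p X).
(* With k and m as set above, [a, phi Y] = 0, [a, Y] = -2 k a and [phi a, Y] = k phi a - 3 k b + 9 k
   t m a; since phi a = b - t m a, only a multiple of a survives. *)
have -> : w = (6 * k * t * m) *: va p.
  by rewrite /w /vc -/m; apply/rowP => i; rewrite !mxE; ring.
(* Pairing with a, where dot (phi a) a = - t m^2, leaves a product of nonzero factors equal to 0. *)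
rewrite phidefZ phidef_va => /(congr1 (fun u => dot u (va p))).
rewrite dot0l dotZl /vc dotDl dotNl vb_dot_va dotZl -/m => /esym/eqP.
rewrite sub0r mulrN oppr_eq0 !mulf_eq0 pnatr_eq0 subr_eq0.
by rewrite (negPf Q1) (negPf t0) /m dot_eq0 (negPf a0).
Qed.

(** * Smooth dependence on the parameter *)

Lemma time_domain_open (e : R) : open (@time_domain R d e).
Proof.
have -> : @time_domain R d e = ((fst @^-1` [set s : R^o | `|s| < e])
    `&` (snd @^-1` [set x : V | x != 0]))%classic by [].
apply: openI; apply: open_comp => [tx _|].
- exact: cvg_fst.
- apply: (@open_comp _ _ (fun s : R^o => `|s|) [set s | s < e]%classic).
    by move=> s _; exact: norm_continuous.
  exact: open_lt.
- exact: cvg_snd.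
- exact: open_neq0.
Qed.

Lemma smoothn_snd {W : normedModType R} n e (f : V -> W) :
  smoothn n [set x : V | x != 0]%classic f ->
  smoothn n (@time_domain R d e) (fun tx => f tx.2).
Proof.
move=> sf; apply: (@smoothn_precomp _ _ _ _ snd n _ _ f _ _ _ sf).
- exact: time_domain_open.
- by move=> tx; exact: cvg_snd.
- by case=> s x [].
Qed.

Lemma smooth_metric_family_gdef e : smooth_metric_family e gdef.
Proof.
move=> X Y [/smooth_onP sX _] [/smooth_onP sY _]; apply/smooth_onP => n.
have oU := @time_domain_open e.
have st : smoothn n (@time_domain R d e) (fun tx => tx.1 : R^o).
  apply: (@smoothn_lin _ _ _ _ fst n _ id) => //; last exact: smoothn_id.
  by move=> tx; exact: cvg_fst.
have sn := smoothn_snd e (@smoothn_nu R d n).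
have sX' := smoothn_snd e (sX n); have sY' := smoothn_snd e (sY n).
have dot_smooth := smoothn_dot (n := n) oU
  (f := fun tx => shear tx.1 (nu tx.2) (ray_ext X tx.2))
  (g := fun tx => shear tx.1 (nu tx.2) (ray_ext Y tx.2)).
by apply: dot_smooth; exact: smoothn_shear.
Qed.

Lemma smooth_vector_family_J e : smooth_vector_family e (fun=> J).
Proof.
apply/smooth_onP => n; apply: smoothn_snd.
by apply: smoothn_linear; [exact: open_neq0|exact: smoothn_nu].
Qed.

Lemma gdef0 : eq_metric (gdef 0) (@round_metric R d).
Proof. by move=> p u v _ _ _; rewrite /gdef /shear !mul0r !scale0r !addr0. Qed.

End Deformation.

(** * Complex projections and a quaternionic rotation *)

Section ComplexLines.
Set Implicit Arguments.
Unset Strict Implicit.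
Context {R : realType} {d : nat}.
Local Notation V := 'rV[R]_d.

(** For a unit vector [e], the orthogonal projection onto the complex line through [e]. *)
Definition cproj (J : V -> V) (e u : V) : V :=
  dot u e *: e + dot u (J e) *: J e.

Lemma cproj_linear (J : V -> V) e : linear (cproj J e).
Proof.
by move=> k u v; rewrite /cproj !dotE; apply/rowP => i; rewrite !mxE; ring.
Qed.
HB.instance Definition _ J e :=
  GRing.isLinear.Build R V V _ (cproj J e) (cproj_linear J e).

(* On the complex plane spanned by the orthonormal [e], [f], this is the left
   multiplication by the quaternion j, [(z, w) |-> (- conj w, conj z)]. *)
Definition quat (J : V -> V) (e f u : V) : V :=
  dot u e *: f - dot u f *: e + dot u (J f) *: J e - dot u (J e) *: J f.

Lemma quat_linear (J : V -> V) e f : linear (quat J e f).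
Proof.
by move=> k u v; rewrite /quat !dotE; apply/rowP => i; rewrite !mxE; ring.
Qed.
HB.instance Definition _ J e f :=
  GRing.isLinear.Build R V V _ (quat J e f) (quat_linear J e f).

Context (J : {linear V -> V}).
Context (Jskew : forall u v, dot (J u) v = - dot u (J v))
        (JJ : forall u, J (J u) = - u).

Lemma cproj_sym e u v : dot (cproj J e u) v = dot u (cproj J e v).
Proof. by rewrite /cproj !dotE !(dotC v) !(dotC _ v); ring. Qed.

Lemma cprojJ e u : cproj J e (J u) = J (cproj J e u).
Proof.
rewrite /cproj linearD ![J (_ *: _)]linearZ /= JJ !Jskew JJ dotNr.
by apply/rowP => i; rewrite !mxE; ring.
Qed.

Lemma cproj_idem e u : dot e e = 1 -> cproj J e (cproj J e u) = cproj J e u.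
Proof.
move=> ee; have eJ := dotJ Jskew e.
rewrite {1}/cproj /cproj !dotE !(dotC (J e) e) eJ (dotJJ Jskew JJ) ee.
by rewrite !(mulr0, mulr1, addr0, add0r).
Qed.

Lemma cproj_orth e f u : dot e f = 0 -> dot e (J f) = 0 ->
  cproj J e (cproj J f u) = 0.
Proof.
move=> ef eJf; have Jef : dot (J e) f = 0 by rewrite Jskew eJf oppr0.
rewrite {1}/cproj /cproj !dotE !(dotC _ e) !(dotC _ (J e)) ef eJf Jef.
by rewrite (dotJJ Jskew JJ) ef !mulr0 !addr0 !scale0r addr0.
Qed.

Lemma quat_skew e f u v : dot (quat J e f u) v = - dot u (quat J e f v).
Proof.
by rewrite /quat !dotE !(dotC _ v); ring.
Qed.

Lemma quatJ e f u : quat J e f (J u) = - J (quat J e f u).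
Proof.
rewrite /quat !linearB linearD linearB ![J (_ *: _)]linearZ /=.
rewrite !JJ !Jskew !JJ !dotNr.
by apply/rowP => i; rewrite !mxE; ring.
Qed.

Lemma quat_cproj e f h u :
  dot e h = 0 -> dot e (J h) = 0 -> dot f h = 0 -> dot f (J h) = 0 ->
  quat J e f (cproj J h u) = 0.
Proof.
move=> eh eJh fh fJh.
have Jeh : dot (J e) h = 0 by rewrite Jskew eJh oppr0.
have Jfh : dot (J f) h = 0 by rewrite Jskew fJh oppr0.
rewrite /quat /cproj !dotE !(dotC _ e) !(dotC _ f).
rewrite !(dotC _ (J e)) !(dotC _ (J f)) eh eJh fh fJh Jeh Jfh.
rewrite !(dotJJ Jskew JJ) eh fh !mulr0 !addr0 !scale0r.
by rewrite !subr0 addr0.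
Qed.

Lemma cproj_quat e f h u :
  dot e h = 0 -> dot e (J h) = 0 -> dot f h = 0 -> dot f (J h) = 0 ->
  cproj J h (quat J e f u) = 0.
Proof.
move=> eh eJh fh fJh.
have Jeh : dot (J e) h = 0 by rewrite Jskew eJh oppr0.
have Jfh : dot (J f) h = 0 by rewrite Jskew fJh oppr0.
rewrite /cproj /quat !dotE eh eJh fh fJh Jeh Jfh !(dotJJ Jskew JJ) eh fh.
by rewrite !mulr0 !(oppr0, addr0) !scale0r addr0.
Qed.

End ComplexLines.

(** * The standard complex structure in coordinates *)

Section Standard.
Set Implicit Arguments.
Unset Strict Implicit.
Context {R : realType} (n : nat).
Local Notation V := 'rV[R]_(2 * n + 2).

(** Real coordinates j and 2n + 1 - j form one complex coordinate; pairing by [rev_ord] avoids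
    splitting the index type. *)
Definition stdJ (u : V) : V :=
  \row_j ((-1) ^+ (j < n.+1)%N * u 0 (rev_ord j)).

Lemma stdJ_linear : linear stdJ.
Proof. by move=> k u v; apply/rowP => i; rewrite !mxE; ring. Qed.
HB.instance Definition _ := GRing.isLinear.Build R V V _ stdJ stdJ_linear.

Lemma rev_low (j : 'I_(2 * n + 2)) : (rev_ord j < n.+1)%N = ~~ (j < n.+1)%N.
Proof. by have := ltn_ord j; rewrite /=; lia. Qed.

Lemma stdJ_skew (u v : V) : dot (stdJ u) v = - dot u (stdJ v).
Proof.
rewrite /dot (reindex_inj rev_ord_inj) -sumrN; apply: eq_bigr => j _.
by rewrite !mxE rev_ordK rev_low; case: (j < n.+1)%N => /=; ring.
Qed.

Lemma stdJJ (u : V) : stdJ (stdJ u) = - u.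
Proof.
apply/rowP => j; rewrite !mxE rev_ordK rev_low.
by case: (j < n.+1)%N => /=; ring.
Qed.

Lemma low_lt (k : 'I_n.+1) : (k < 2 * n + 2)%N.
Proof. by have := ltn_ord k; lia. Qed.

Definition stde (k : 'I_n.+1) : V := delta_mx 0 (Ordinal (low_lt k)).

Lemma stde_dot k (v : V) : dot (stde k) v = v 0 (Ordinal (low_lt k)).
Proof.
rewrite /dot (bigD1 (Ordinal (low_lt k))) //= big1 => [|j jk].
  by rewrite mxE !eqxx mul1r addr0.
by rewrite mxE (negPf jk) mul0r.
Qed.

Lemma stde_orth k l : dot (stde k) (stde l) = (k == l)%:R.
Proof. by rewrite stde_dot mxE. Qed.

(** [stde k] is supported in the lower half of the coordinates, whereas [stdJ] moves [stde l] to the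
    upper half. *)
Lemma stde_orthJ k l : dot (stde k) (stdJ (stde l)) = 0.
Proof.
rewrite stde_dot mxE mxE eqxx /=.
case: eqP => [/(congr1 val) /=|_]; last by rewrite mulr0.
by have := ltn_ord k; have := ltn_ord l; lia.
Qed.

End Standard.

(** * The deformation of the round sphere *)

Theorem proposition4p4 (R : realType) (n : nat) (hn : (3 <= n)%N) :
  exists (e : R) (g : R -> 'rV[R]_(2 * n + 2) -> 'rV[R]_(2 * n + 2) ->
                      'rV[R]_(2 * n + 2) -> R)
         (xi : R -> 'rV[R]_(2 * n + 2) -> 'rV[R]_(2 * n + 2)),
    [/\ 0 < e,
        smooth_metric_family e g /\ smooth_vector_family e xi,
        eq_metric (g 0) round_metric,
        forall t : R, `|t| < e -> k_contact (g t) (xi t)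
      & forall t : R, `|t| < e -> t != 0 ->
          ~ sasakian (g t) (xi t) /\
          exists X : 'rV[R]_(2 * n + 2) -> 'rV[R]_(2 * n + 2),
            g2_component (g t) (xi t) X /\
            ~ constant_on_sphere (length (g t) X)].
Proof.
pose V := 'rV[R]_(2 * n + 2).
pose J : {linear V -> V} := @stdJ R n.
have Jskew u v : dot (J u) v = - dot u (J v) := stdJ_skew u v.
have JJ u : J (J u) = - u := stdJJ u.
(* Here n >= 3 enters: two complex lines carry the shear and two others the rotation. *)
have lt4 k : (k < 4)%N -> (k < n.+1)%N by move=> /leq_trans; apply.
pose ee (k : 'I_4) : V := @stde R n (Ordinal (lt4 k (ltn_ord k))).
have eeE k l : dot (ee k) (ee l) = (k == l)%:R by exact: stde_orth.
have eeJ k l : dot (ee k) (J (ee l)) = 0 by exact: stde_orthJ.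
pose e0 := ee (@Ordinal 4 0 isT). pose e1 := ee (@Ordinal 4 1 isT).
pose e2 := ee (@Ordinal 4 2 isT). pose e3 := ee (@Ordinal 4 3 isT).
pose P1 : {linear V -> V} := cproj J e0.
pose P2 : {linear V -> V} := cproj J e1.
pose A : {linear V -> V} := quat J e2 e3.
have ne (k l : 'I_4) : k != l -> dot (ee k) (ee l) = 0.
  by move=> /negPf kl; rewrite eeE kl.
have Ee : (dot e0 e0 = 1) * (dot e1 e1 = 1) * (dot e2 e2 = 1) * (dot e3 e3 = 1).
  by rewrite /e0 /e1 /e2 /e3 !eeE !eqxx.
have En : (dot e0 e1 = 0) * (dot e1 e0 = 0) * (dot e2 e3 = 0) *
  (dot e0 e2 = 0) * (dot e1 e2 = 0) * (dot e2 e0 = 0) * (dot e2 e1 = 0) *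
  (dot e0 e3 = 0) * (dot e3 e0 = 0) * (dot e3 e1 = 0).
  by rewrite /e0 /e1 /e2 /e3 !ne.
have EJ : (dot e0 (J e0) = 0) * (dot e0 (J e1) = 0) * (dot e1 (J e0) = 0) *
  (dot e1 (J e1) = 0) * (dot e2 (J e0) = 0) * (dot e2 (J e1) = 0) *
  (dot e0 (J e2) = 0) * (dot e0 (J e3) = 0) * (dot e2 (J e2) = 0) *
  (dot e2 (J e3) = 0) * (dot e3 (J e0) = 0) * (dot e3 (J e1) = 0).
  by rewrite /e0 /e1 /e2 /e3 !eeJ.
have P1sym u v : dot (P1 u) v = dot u (P1 v) by exact: cproj_sym.
have P2sym u v : dot (P2 u) v = dot u (P2 v) by exact: cproj_sym.
have P11 u : P1 (P1 u) = P1 u by apply: cproj_idem; rewrite ?Ee.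
have P22 u : P2 (P2 u) = P2 u by apply: cproj_idem; rewrite ?Ee.
have P12 u : P1 (P2 u) = 0 by apply: cproj_orth; rewrite ?En ?EJ.
have P21 u : P2 (P1 u) = 0 by apply: cproj_orth; rewrite ?En ?EJ.
have P1J u : P1 (J u) = J (P1 u) by exact: cprojJ.
have P2J u : P2 (J u) = J (P2 u) by exact: cprojJ.
have Askew u v : dot (A u) v = - dot u (A v) by exact: quat_skew.
have AJ u : A (J u) = - J (A u) by exact: quatJ.
have AP1 u : A (P1 u) = 0 by apply: quat_cproj; rewrite ?En ?EJ.
have AP2 u : A (P2 u) = 0 by apply: quat_cproj; rewrite ?En ?EJ.
have P1A u : P1 (A u) = 0 by apply: cproj_quat; rewrite ?En ?EJ.
have P2A u : P2 (A u) = 0 by apply: cproj_quat; rewrite ?En ?EJ.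
(* The metrics are K-contact for every real t, so the bound 1 is arbitrary. *)
exists 1, (gdef J P1 P2), (fun=> J); split => //.
- split; [exact: smooth_metric_family_gdef|exact: smooth_vector_family_J].
- exact: gdef0.
- by move=> t _; exact: k_contact_gdef.
move=> t _ t0.
split.
  (* A rational unit vector with components on both lines, so that [va p] is nonzero, and one off
     them, so that sqQ = 8/9 differs from 1. *)
  pose p : V := (2 / 3) *: e0 + (2 / 3) *: e1 + 3^-1 *: e2.
  have Sp : unit_sphere p.
    by rewrite /unit_sphere /= /p !dotE !Ee !En; field.
  have P1p : P1 p = (2 / 3) *: e0.
    rewrite -[P1 p]/(cproj J e0 p) /cproj /p !dotE !Ee !En !EJ.
    by apply/rowP => i; rewrite !mxE; ring.
  have P2p : P2 p = (2 / 3) *: e1.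
    rewrite -[P2 p]/(cproj J e1 p) /cproj /p !dotE !Ee !En !EJ.
    by apply/rowP => i; rewrite !mxE; ring.
  have s1 : sq1 P1 p = 4 / 9 by rewrite /sq1 P1p !dotE Ee; field.
  have s2 : sq2 P2 p = 4 / 9 by rewrite /sq2 P2p !dotE Ee; field.
  apply: (not_sasakian Jskew JJ P1sym P2sym P11 P22 P12 P21 P1J P2J t0 Sp).
    (* The [e1] component of [va p] is 8/27. *)
    apply/eqP => /(congr1 (dot e1)); rewrite vaE P1p P2p s1 s2 !dotE Ee En.
    lra.
  by rewrite /sqQ s1 s2; apply/eqP; lra.
exists A; split; first exact: g2_A.
move=> [c cA].
(* The length of [A] is 0 at [e0], which [A] kills, and 1 at [e2], which [A] sends to [e3]. *)
have S0 : unit_sphere e0 by rewrite /unit_sphere /= Ee.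
have S2 : unit_sphere e2 by rewrite /unit_sphere /= Ee.
have := cA e0 S0; have := cA e2 S2.
rewrite !length_A //.
have -> : A e0 = 0.
  rewrite -[A e0]/(quat J e2 e3 e0) /quat !En !EJ.
  by apply/rowP => i; rewrite !mxE; ring.
have -> : A e2 = e3.
  rewrite -[A e2]/(quat J e2 e3 e2) /quat !En !EJ !Ee.
  by apply/rowP => i; rewrite !mxE; ring.
by rewrite dot0l Ee sqrtr0 sqrtr1 => <- /eqP; rewrite eq_sym oner_eq0.
Qed.
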